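(* Let $d\geq 3$, let $\Bbbk$ be an algebraically closed field with $\operatorname{char}\Bbbk=0$ or $\operatorname{char}\Bbbk>d$, and let $H_1,\ldots,H_{d+4}$ be hyperplanes in $\mathbb{P}^d=\mathbb{P}^d_{\Bbbk}$ in general linear position which osculate a rational normal curve. Then for every $6$-element subset $I=\{i_1<\ldots<i_6\}\subseteq\{1,\ldots,d+4\}$, with complement $I^c=\{j_1<\ldots<j_{d-2}\}$, the following $d+1$ hyperplanes have nonempty common intersection: \begin{itemize} \item the linear span of $H_{i_1}\cap H_{i_2}$ with the point $H_{i_4}\cap H_{i_5}\cap H_{j_1}\cap \ldots\cap H_{j_{d-2}}$; \item the linear span of $H_{i_2}\cap H_{i_3}$ with the point $H_{i_5}\cap H_{i_6}\cap H_{j_1}\cap\ldots\cap H_{j_{d-2}}$; \item the linear span of $H_{i_3}\cap H_{i_4}$ with the point $H_{i_6}\cap H_{i_1}\cap H_{j_1}\cap\ldots\cap H_{j_{d-2}}$; \item the hyperplanes $H_{j_1},\ldots,H_{j_{d-2}}$. \end{itemize}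
   Context: A rational normal curve in $\mathbb{P}^d$ is a smooth rational curve of degree $d$ in $\mathbb{P}^d$. Hyperplanes of $\mathbb{P}^d$ are in general linear position if the corresponding points of the dual projective space $(\mathbb{P}^d)^*$ are, i.e. any $d+1$ of the hyperplanes have empty common intersection. The hyperplanes $H_1,\ldots,H_{d+4}$ osculate a rational normal curve if there is a single rational normal curve $C\subset\mathbb{P}^d$ such that each $H_i$ is an osculating hyperplane of $C$ at some point $p_i\in C$, i.e. $H_i$ meets $C$ at $p_i$ with intersection multiplicity $d$.
   Formalization: A rational normal curve is here required to span P^d, as is usual; read literally, ''smooth rational curve of degree d in P^d'' also admits curves lying in a hyperplane, for which the claim fails (for example for d = 12). *)

(* Defs.v *)
From HB Require Import structures.
From mathcomp Require Import all_boot all_order all_algebra.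

Set Implicit Arguments.
Unset Strict Implicit.
Unset Printing Implicit Defensive.

Import GRing.Theory.
Local Open Scope ring_scope.

(* Points of P^m are the nonzero vectors of 'rV[k]_m.+1 up to scaling, linear
   subspaces of P^m are the subspaces of 'rV[k]_m.+1, and the empty subspace of
   P^m is 0%VS. A point of the dual space is a nonzero column vector up to
   scaling. *)

Definition hyperplane (k : fieldType) (m : nat) (h : 'cV[k]_m) :
    {vspace 'rV[k]_m} :=
  lker (linfun (mulmxr h : 'rV[k]_m -> 'rV[k]_1)).

Definition general_linear_position (k : fieldType) (d n : nat)
    (h : 'I_n -> 'cV[k]_d.+1) : Prop :=
  forall J : {set 'I_n}, #|J| = d.+1 ->
    (\bigcap_(j in J) hyperplane (h j))%VS = 0%VS.

Definition monomials (R : comNzRingType) (n : nat) (u : 'rV[R]_2) :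
    'rV[R]_n.+1 :=
  \row_(j < n.+1) (u 0 0 ^+ (n - j) * u 0 1 ^+ j).

(* Column c of F lists the coefficients of a binary form F_c of degree n;
   F encodes the map P^1 -> P^d given by (F_0 : ... : F_d). *)
Definition curve_map (R : comNzRingType) (n d : nat) (F : 'M[R]_(n.+1, d.+1))
    (u : 'rV[R]_2) : 'rV[R]_d.+1 :=
  monomials n u *m F.

(* For u, v linearly independent, 'X is a local coordinate of P^1 at the point
   u, through 'X |-> u + 'X v; this is the expansion of the map at u. *)
Definition local_expansion (k : fieldType) (n d : nat)
    (F : 'M[k]_(n.+1, d.+1)) (u v : 'rV[k]_2) : 'rV[{poly k}]_d.+1 :=
  curve_map (map_mx polyC F) (map_mx polyC u + 'X *: map_mx polyC v).

Definition derivative_along (k : fieldType) (n d : nat)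
    (F : 'M[k]_(n.+1, d.+1)) (u v : 'rV[k]_2) : 'rV[k]_d.+1 :=
  \row_c (local_expansion F u v 0 c)`_1.

(* A smooth rational curve of degree n in P^d is the image of an embedding of
   P^1 by binary forms of degree n without common zero. *)
Record smooth_rational_curve (k : fieldType) (n d : nat)
    (F : 'M[k]_(n.+1, d.+1)) : Prop := SmoothRationalCurve {
  no_base_point : forall u, u != 0 -> curve_map F u != 0;
  separates_points : forall u v, u != 0 -> v != 0 ->
    curve_map F u \in <[curve_map F v]>%VS -> u \in <[v]>%VS;
  separates_tangents : forall u v, free [:: u; v] ->
    free [:: curve_map F u; derivative_along F u v] }.

Definition nondegenerate (k : fieldType) (n d : nat)
    (F : 'M[k]_(n.+1, d.+1)) : Prop :=
  forall h : 'cV[k]_d.+1,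
    (forall u, curve_map F u \in hyperplane h) -> h = 0.

(* "A smooth rational curve of degree d in P^d" is understood, as usual, to
   span P^d. *)
Definition rational_normal_curve (k : fieldType) (d : nat)
    (F : 'M[k]_(d.+1, d.+1)) : Prop :=
  smooth_rational_curve F /\ nondegenerate F.

Definition local_equation (k : fieldType) (n d : nat)
    (F : 'M[k]_(n.+1, d.+1)) (h : 'cV[k]_d.+1) (u v : 'rV[k]_2) : {poly k} :=
  (local_expansion F u v *m map_mx polyC h) 0 0.

(* The order of vanishing at u does not depend on the auxiliary v. It is
   infinite when the local equation is 0, whereas mup 0 0 = 0. *)
Definition intersection_multiplicity_eq (k : fieldType) (n d : nat)
    (F : 'M[k]_(n.+1, d.+1)) (h : 'cV[k]_d.+1) (u : 'rV[k]_2) (m : nat) :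
    Prop :=
  forall v, free [:: u; v] ->
    local_equation F h u v != 0 /\ mup 0 (local_equation F h u v) = m.

Definition osculating_hyperplane (k : fieldType) (d : nat)
    (F : 'M[k]_(d.+1, d.+1)) (h : 'cV[k]_d.+1) (u : 'rV[k]_2) : Prop :=
  intersection_multiplicity_eq F h u d.

Definition osculate_rational_normal_curve (k : fieldType) (d n : nat)
    (h : 'I_n -> 'cV[k]_d.+1) : Prop :=
  exists F : 'M[k]_(d.+1, d.+1), rational_normal_curve F /\
    forall i, exists2 u, u != 0 & osculating_hyperplane F (h i) u.

(* Main.v *)
Require Import Defs.
From mathcomp Require Import all_boot all_order all_algebra.
From mathcomp Require Import ring.

Set Implicit Arguments.
Unset Strict Implicit.
Unset Printing Implicit Defensive.

Import GRing.Theory.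
Local Open Scope ring_scope.

(** In the coordinates of P^d given by the rational normal curve, a hyperplane
    meeting the curve at a single point with multiplicity d is the coefficient
    vector of the d-th power of the linear form vanishing at that point
    ([osculating_hyperplane_power]). The assumption on the characteristic makes
    the binomial coefficients 'C(d, j) invertible, so by apolarity every point
    of P^d is a binary form of degree d, and it lies on the hyperplane osculating
    at (u_0 : u_1) exactly when that form vanishes at (u_0 : - u_1)
    ([polar_point_pairing]). Let p_i be this last point for the i-th hyperplane;
    general linear position forces the p_i to be distinct ([bracket_neq0]).

    Let L_i be the linear form vanishing at p_i, and P the product of the L_j for
    j outside I. The intersection of the H_j, j outside I, is the plane of
    multiples of P, hence a plane of binary quadratic forms, and H_i /\ H_j meets
    it in the point L_i L_j P. What remains is Brianchon's theorem for the
    hexagon whose sides are the tangents to a conic at the points of parameters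
    p_1, ..., p_6: the lines joining L_1 L_2 to L_4 L_5, L_2 L_3 to L_5 L_6 and L_3 L_4 to L_6 L_1 are
    concurrent. A common point is written explicitly with the brackets
    [ij], the values of L_i at p_j:

      [53][64] L_1 L_2 - [62][13] L_4 L_5 = [24][13] L_5 L_6 - [15][64] L_2 L_3.

    Shifting all the indices cyclically by one turns the right-hand side into
    a combination of L_6 L_1 and L_3 L_4, and the left-hand side into the
    opposite of the right-hand side above; so the same form is on all three
    lines ([brianchon_identity], used twice). It is not zero: its first term
    vanishes at p_1 and its second one does not. *)

(** * Powers of linear forms as osculating hyperplanes *)

Lemma mem_hyperplane (k : fieldType) m (h : 'cV[k]_m) (x : 'rV[k]_m) :
  (x \in hyperplane h) = (x *m h == 0).
Proof. by rewrite memv_ker lfunE. Qed.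

Lemma mem_bigcapv (k : fieldType) (V : vectType k) (I : finType)
    (P : pred I) (U : I -> {vspace V}) (x : V) :
  reflect (forall i, P i -> x \in U i) (x \in \bigcap_(i | P i) U i)%VS.
Proof.
by rewrite memvE; apply: (iffP subv_bigcapP) => xU i Pi;
  have := xU i Pi; rewrite memvE.
Qed.

Lemma row2_eq0 (k : fieldType) (u : 'rV[k]_2) :
  u 0 0 = 0 -> u 0 1 = 0 -> u = 0.
Proof.
move=> u0 u1; apply/rowP => i; rewrite mxE.
suff [-> | ->] : i = 0 \/ i = 1 by [].
by case: i => [[|[|//]]] lti; [left | right]; apply: val_inj.
Qed.

Lemma prime_ndvd_fact (p n : nat) : prime p -> (n < p)%N -> ~~ (p %| n`!)%N.
Proof.
move=> p_pr; elim: n => [|n IHn] ltnp.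
  by rewrite fact0 Euclid_dvd1.
by rewrite factS Euclid_dvdM // gtnNdvd // IHn // ltnW.
Qed.

Lemma bin_neq0 (k : fieldType) (d j : nat) :
    [pchar k] =i pred0 \/ (exists2 p, p \in [pchar k] & (d < p)%N) ->
  (j <= d)%N -> 'C(d, j)%:R != 0 :> k.
Proof.
move=> hchar lejd; case: hchar => [/pcharf0P -> | [p pk ltdp]].
  by rewrite -lt0n bin_gt0.
rewrite -(dvdn_pcharf pk); apply: contra (prime_ndvd_fact (pcharf_prime pk) ltdp).
by move=> pC; rewrite -(bin_fact lejd) dvdn_mulr.
Qed.

Lemma nondegenerate_unitmx (k : fieldType) d (F : 'M[k]_d.+1) :
  Defs.nondegenerate F -> F \in unitmx.
Proof.
move=> ndF; rewrite -unitmx_tr -row_free_unit; apply: inj_row_free => v vF0.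
apply: trmx_inj; rewrite trmx0; apply: ndF => u.
by rewrite mem_hyperplane /curve_map -mulmxA -[F]trmxK -trmx_mul vF0 trmx0 mulmx0.
Qed.

Lemma local_equationE (k : fieldType) d (F : 'M[k]_d.+1) (h : 'cV[k]_d.+1)
    (u v : 'rV[k]_2) :
  local_equation F h u v =
  \sum_(j < d.+1) ((F *m h) j 0)%:P *
     (((u 0 0)%:P + 'X * (v 0 0)%:P) ^+ (d - j) *
      ((u 0 1)%:P + 'X * (v 0 1)%:P) ^+ j).
Proof.
rewrite /local_equation /local_expansion /curve_map -mulmxA -map_mxM mxE.
by apply: eq_bigr => j _; rewrite !mxE mulrC.
Qed.

Lemma coef_vanishing_order (k : fieldType) (q : {poly k}) (d : nat) :
  q != 0 -> mup 0 q = d -> forall j, (j < d)%N -> q`_j = 0.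
Proof.
move=> q0 mq j ltjd; have : ('X - 0%:P) ^+ d %| q by rewrite -mup_geq // mq.
rewrite subr0 => /dvdpP [r ->]; by rewrite coefMXn ltjd.
Qed.

(** The restriction of an osculating hyperplane to the curve is a form of degree
    d with a single zero, at u, hence a multiple of the d-th power of the linear
    form u_0 Y - u_1 X; column F *m h lists its coefficients on the monomials
    X^(d-j) Y^j. *)
Lemma osculating_hyperplane_power (k : fieldType) d (F : 'M[k]_d.+1)
    (h : 'cV[k]_d.+1) (u : 'rV[k]_2) :
    u != 0 -> osculating_hyperplane F h u ->
  exists c : k, forall j : 'I_d.+1,
    (F *m h) j 0 = c * ('C(d, j)%:R * (u 0 0 ^+ j * (- u 0 1) ^+ (d - j))).
Proof.
move=> u0 osc.
have [u00 | u00] := eqVneq (u 0 0) 0.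
  have u01 : u 0 1 != 0.
    by apply: contra u0 => /eqP u01; apply/eqP/row2_eq0.
  (* The local coordinate at u = (0 : 1) is X / Y, and the coefficient of 'X^(d-j)
     in the local equation is a multiple of the j-th coefficient of F *m h. *)
  pose v : 'rV[k]_2 := delta_mx 0 0.
  have uv : free [:: u; v].
    rewrite free_cons seq1_free span_seq1; apply/andP; split; last first.
      by apply/eqP => /rowP /(_ 0) /eqP; rewrite !mxE oner_eq0.
    apply/negP => /vlineP [a /rowP /(_ 1) /eqP]; rewrite !mxE /= mulr0.
    exact/negP.
  have [q0 mq] := osc v uv.
  have [v0 v1] : v 0 0 = 1 /\ v 0 1 = 0 by split; rewrite !mxE.
  have /= Fh j := coef_vanishing_order q0 mq (j := j).
  exists ((F *m h) 0 0 / (- u 0 1) ^+ d) => j.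
  case: (posnP j) => [j0 | jgt0].
    have -> : j = 0 by apply: val_inj.
    by rewrite subn0 bin0 expr0 !mul1r divfK // expf_neq0 // oppr_eq0.
  rewrite u00 expr0n eqn0Ngt jgt0 mul0r !mulr0.
  have := Fh (d - j)%N; rewrite local_equationE coef_sum ltn_subrL jgt0 /=.
  rewrite (leq_trans jgt0) -1?ltnS // => /(_ isT).
  rewrite (bigD1 j) //= big1 ?addr0 => [|i neij].
    rewrite v0 v1 u00 mulr1 mulr0 add0r addr0 -polyC_exp.
    rewrite coefCM coefMC coefXn eqxx mul1r => /eqP.
    by rewrite mulf_eq0 expf_eq0 (negPf u01) andbF orbF => /eqP.
  rewrite v0 v1 u00 mulr1 mulr0 add0r addr0 -polyC_exp.
  rewrite coefCM coefMC coefXn; case: eqP => [eqij|]; last by rewrite mul0r mulr0.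
  case/eqP: neij; apply: val_inj => /=.
  by rewrite -(subKn (ltn_ord i : i <= d)%N) -eqij subKn // -ltnS.
(* In the chart u_0 != 0 the first coordinate is constant along u + 'X v, so the
   local equation is the translate by u_1 of a polynomial p with coefficients
   proportional to those of F *m h. *)
pose v : 'rV[k]_2 := delta_mx 0 1.
have uv : free [:: u; v].
  rewrite free_cons seq1_free span_seq1; apply/andP; split; last first.
    by apply/eqP => /rowP /(_ 1) /eqP; rewrite !mxE oner_eq0.
  apply/negP => /vlineP [a /rowP /(_ 0) /eqP]; rewrite !mxE /= mulr0.
  exact/negP.
have [q0 mq] := osc v uv.
have [v0 v1] : v 0 0 = 0 /\ v 0 1 = 1 by split; rewrite !mxE.
pose p := \poly_(j < d.+1) ((F *m h) (inord j) 0 * u 0 0 ^+ (d - j)).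
have pE (j : 'I_d.+1) : p`_j = (F *m h) j 0 * u 0 0 ^+ (d - j).
  by rewrite coef_poly ltn_ord inord_val.
have qE : local_equation F h u v = p \Po ('X + (u 0 1)%:P).
  rewrite local_equationE /p poly_def raddf_sum /=; apply: eq_bigr => j _.
  rewrite comp_polyZ comp_Xn_poly inord_val -mul_polyC polyCM -mulrA polyC_exp.
  by rewrite v0 v1 mulr0 addr0 mulr1 [_ + 'X]addrC.
have sq : (size (local_equation F h u v) <= d.+1)%N.
  by rewrite qE size_comp_poly2 ?size_XaddC // size_poly.
have [c qX] : exists c : k, local_equation F h u v = c *: 'X^d.
  exists (local_equation F h u v)`_d; apply/polyP => j.
  rewrite coefZ coefXn; case: (ltngtP j d) => [ltjd | ltdj | ->].
  - by rewrite (coef_vanishing_order q0 mq) // mulr0.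
  - by rewrite nth_default ?mulr0 // (leq_trans sq).
  - by rewrite mulr1.
have pX : p = \poly_(j < d.+1) (c * ((- u 0 1) ^+ (d - j) *+ 'C(d, j))).
  rewrite -[p](comp_polyXaddC_K _ (u 0 1)) -qE qX comp_polyZ comp_Xn_poly.
  rewrite addrC -polyCN exprDn poly_def scaler_sumr; apply: eq_bigr => j _.
  by rewrite -polyC_exp mul_polyC scalerMnl scalerA.
exists (c / u 0 0 ^+ d) => j.
apply: (mulIf (expf_neq0 (d - j) u00)); rewrite -pE pX coef_poly ltn_ord.
rewrite -[in u 0 0 ^+ d](subnK (ltn_ord j : j <= d)%N) exprD -mulr_natl.
by field; rewrite !expf_neq0.
Qed.

(** * Binary forms as vectors *)

(** A binary form of degree n is encoded by its dehomogenization p; the degree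
    has to be recalled, as p loses the factors that vanish at (1 : 0). *)
Definition binary_form_value (k : fieldType) (n : nat) (p : {poly k})
    (s t : k) : k :=
  \sum_(j < n.+1) p`_j * (s ^+ j * t ^+ (n - j)).

Lemma binary_form_value_linear (k : fieldType) n (a b s t : k) (q : {poly k}) :
    (size q <= n.+1)%N ->
  binary_form_value n.+1 ((b%:P * 'X - a%:P) * q) s t =
  (b * s - a * t) * binary_form_value n q s t.
Proof.
move=> sq; rewrite /binary_form_value.
under eq_bigr => j _ do
  rewrite mulrBl coefB -mulrA !coefCM coefXM mulrBl -!mulrA.
rewrite sumrB big_ord_recl mul0r mulr0 add0r [X in _ - X]big_ord_recr /=.
rewrite (nth_default 0 sq) mul0r mulr0 addr0 mulrBl !mulr_sumr.
congr (_ - _); apply: eq_bigr => j _.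
  by rewrite /= add0n subSS exprS; ring.
by rewrite (subSn (ltn_ord j : j <= n)%N) [t ^+ _.+1]exprS; ring.
Qed.

Section LinearFactors.

Variables (k : fieldType) (I : finType) (a b : I -> k).

(** Vanishes at (a i : b i). It is a constant when b i = 0, so vanishing at a point
    cannot be expressed by divisibility of polynomials. *)
Definition linear_factor (i : I) : {poly k} := (b i)%:P * 'X - (a i)%:P.

Definition linear_product (A : {set I}) : {poly k} :=
  \prod_(i in A) linear_factor i.

(** The value of the i-th linear factor at the j-th point. *)
Definition bracket (i j : I) : k := b i * a j - a i * b j.

Lemma bracket_diag i : bracket i i = 0.
Proof. by rewrite /bracket; ring. Qed.

Lemma linear_productU1 i (A : {set I}) :
  i \notin A -> linear_product (i |: A) = linear_factor i * linear_product A.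
Proof. by move=> iA; rewrite /linear_product big_setU1. Qed.

Lemma size_linear_product (A : {set I}) : (size (linear_product A) <= #|A|.+1)%N.
Proof.
apply: leq_trans (size_poly_prod_leq _ _) _.
rewrite leq_subLR addnS ltnS -sum1_card -big_split /= leq_sum // => i _.
rewrite /linear_factor (leq_trans (size_polyD _ _)) // geq_max size_polyN.
rewrite (leq_trans (size_polyC_leq1 _)) // andbT mul_polyC.
by rewrite (leq_trans (size_scale_leq _ _)) // size_polyX.
Qed.

Lemma linear_product_value (A : {set I}) j :
  binary_form_value #|A| (linear_product A) (a j) (b j) =
  \prod_(i in A) bracket i j.
Proof.
move: {2}#|A| (erefl #|A|) => n; elim: n A => [|n IHn] A cardA.
  move/eqP: (cardA); rewrite cards_eq0 => /eqP ->.
  rewrite cards0 /linear_product !big_set0 /binary_form_value big_ord1.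
  by rewrite coefC /= !mulr1.
have /card_gt0P [i iA] : (0 < #|A|)%N by rewrite cardA.
have cardA' : #|A :\ i| = n by move: cardA; rewrite (cardsD1 i) iA => -[].
rewrite -(setD1K iA) linear_productU1 ?setD11 // big_setU1 ?setD11 //=.
rewrite cardsU1 setD11 add1n binary_form_value_linear ?size_linear_product //.
by rewrite IHn.
Qed.

Lemma linear_product_neq0 (A : {set I}) :
  (forall i, (a i != 0) || (b i != 0)) -> linear_product A != 0.
Proof.
move=> ab0; apply/prodf_neq0 => i _; apply/negP => /eqP/polyP Li0.
have := Li0 0%N; have := Li0 1%N; have := ab0 i; rewrite /linear_factor.
rewrite !coefB !coefCM !coefX !coefC /= mulr1 mulr0 subr0 sub0r => /orP.
by case=> /negPf nz /eqP; rewrite ?oppr_eq0 ?nz // => _ /eqP; rewrite oppr_eq0 nz.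
Qed.

(** A form common to the line through L_1 L_2 and L_4 L_5 and to the line through
    L_2 L_3 and L_5 L_6, with denominators cleared. Two combinations
    alpha L_1 L_2 + beta L_4 L_5 and gamma L_2 L_3 + delta L_5 L_6 agree as soon as
    alpha L_1 - gamma L_3 = L_5 and delta L_6 - beta L_4 = L_2, and each of these
    is the linear relation between three linear forms in two variables, whose
    coefficients are brackets. *)
Lemma brianchon_identity (i1 i2 i3 i4 i5 i6 : I) (L := linear_factor) :
  (bracket i5 i3 * bracket i6 i4) *: (L i1 * L i2)
    - (bracket i6 i2 * bracket i1 i3) *: (L i4 * L i5) =
  (bracket i2 i4 * bracket i1 i3) *: (L i5 * L i6)
    - (bracket i1 i5 * bracket i6 i4) *: (L i2 * L i3).
Proof.
rewrite /L /linear_factor /bracket -!mul_polyC.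
rewrite !(polyCM, polyCB).
ring.
Qed.

End LinearFactors.

(** The apolar pairing of two forms of degree d divides the j-th coefficients by
    'C(d, j), and pairing with a d-th power evaluates a form at a point. The
    factor F returns from the coordinates adapted to the curve to those of P^d. *)
Definition polar_point (k : fieldType) d (F : 'M[k]_d.+1) (p : {poly k}) :
    'rV[k]_d.+1 :=
  (\row_j (p`_j / 'C(d, j)%:R)) *m F.

Lemma polar_pointB (k : fieldType) d (F : 'M[k]_d.+1) (a b : k) p q :
  polar_point F (a *: p - b *: q) = a *: polar_point F p - b *: polar_point F q.
Proof.
rewrite /polar_point !scalemxAl -mulmxBl; congr (_ *m F); apply/rowP => j.
by rewrite !mxE coefB !coefZ; ring.
Qed.

Lemma polar_point_neq0 (k : fieldType) d (F : 'M[k]_d.+1) (p : {poly k}) :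
    (forall j, (j <= d)%N -> 'C(d, j)%:R != 0 :> k) -> F \in unitmx ->
    (size p <= d.+1)%N -> p != 0 ->
  polar_point F p != 0.
Proof.
move=> bin0 unitF sp; apply: contra; rewrite -row_free_unit in unitF.
rewrite mulmx_free_eq0 // => /eqP /rowP w0; apply/eqP/polyP => j.
rewrite coef0; case: (ltnP j d.+1) => [ltjd | ledj]; last first.
  by rewrite nth_default // (leq_trans sp).
have := w0 (Ordinal ltjd); rewrite !mxE /= => /eqP.
by rewrite mulf_eq0 invr_eq0 (negPf (bin0 _ _)) // orbF => /eqP.
Qed.

Lemma polar_point_pairing (k : fieldType) d (F : 'M[k]_d.+1) (h : 'cV[k]_d.+1)
    (c s t : k) (p : {poly k}) :
    (forall j, (j <= d)%N -> 'C(d, j)%:R != 0 :> k) ->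
    (forall j : 'I_d.+1,
       (F *m h) j 0 = c * ('C(d, j)%:R * (s ^+ j * t ^+ (d - j)))) ->
  polar_point F p *m h = (c * binary_form_value d p s t)%:M.
Proof.
move=> bin0 Fh; apply/rowP => i; rewrite ord1 /polar_point -mulmxA !mxE mulr1n.
rewrite mulr_sumr; apply: eq_bigr => j _; rewrite Fh !mxE.
by field; rewrite bin0 // -ltnS.
Qed.

(** * Osculating hyperplanes and the hexagon *)

Lemma set_extension (T : finType) (A : {set T}) m :
  (#|A| <= m <= #|T|)%N -> exists2 B : {set T}, A \subset B & #|B| = m.
Proof.
elim: m => [|m IHm] /andP [leAm lemT].
  by exists A => //; apply/eqP; rewrite -leqn0.
move: leAm; rewrite leq_eqVlt => /orP [/eqP cardA | ltAm].
  by exists A.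
have [|B AB cardB] := IHm; first by rewrite -ltnS ltAm ltnW.
have /card_gt0P [x] : (0 < #|~: B|)%N.
  by rewrite cardsCs setCK subn_gt0 cardB.
rewrite inE => xB; exists (x |: B); last by rewrite cardsU1 xB cardB.
exact: subset_trans AB (subsetUr _ _).
Qed.

Section OsculatingFamily.

Variables (k : fieldType) (d n : nat) (F : 'M[k]_d.+1) (h : 'I_n -> 'cV[k]_d.+1).
Variables (a b c : 'I_n -> k).
Hypothesis bin0 : forall j, (j <= d)%N -> 'C(d, j)%:R != 0 :> k.
Hypothesis Fh : forall i (j : 'I_d.+1),
  (F *m h i) j 0 = c i * ('C(d, j)%:R * (a i ^+ j * b i ^+ (d - j))).

(** When A has d elements, the common point of the hyperplanes of A. *)
Definition intersection_point (A : {set 'I_n}) : 'rV[k]_d.+1 :=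
  polar_point F (linear_product a b A).

Lemma intersection_point_pairing (A : {set 'I_n}) j : #|A| = d ->
  intersection_point A *m h j = (c j * \prod_(i in A) bracket a b i j)%:M.
Proof.
move=> cardA; rewrite (polar_point_pairing _ bin0 (Fh j)).
by rewrite -linear_product_value cardA.
Qed.

Lemma mem_intersection_point (A : {set 'I_n}) i j :
    #|A| = d -> i \in A -> bracket a b i j = 0 ->
  intersection_point A \in hyperplane (h j).
Proof.
move=> cardA iA ij0; rewrite mem_hyperplane intersection_point_pairing //.
by rewrite (bigD1 i) //= ij0 mul0r mulr0 raddf0.
Qed.

(** If the osculation points of h i and h j coincide, then the common point of d
    hyperplanes that include h i but not h j is also on h j, against general
    linear position. *)
Lemma bracket_neq0 i j :
    general_linear_position h -> F \in unitmx ->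
    (forall l, (a l != 0) || (b l != 0)) -> (0 < d)%N -> (d < n)%N -> i != j ->
  bracket a b i j != 0.
Proof.
move=> hgen unitF ab0 d0 ltdn neij; apply/negP => /eqP ij0.
have [|J ijJ cardJ] := @set_extension _ [set i; j] d.+1.
  by rewrite cards2 neij card_ord ltdn ltnS d0.
have [iJ jJ] : i \in J /\ j \in J.
  by split; apply: (subsetP ijJ); rewrite !inE eqxx ?orbT.
have cardJ' : #|J :\ j| = d by move: cardJ; rewrite (cardsD1 j) jJ => -[].
have : intersection_point (J :\ j) \in (\bigcap_(l in J) hyperplane (h l))%VS.
  apply/mem_bigcapv => l lJ; have [-> | nelj] := eqVneq l j.
    by apply: mem_intersection_point ij0; rewrite // !inE neij.
  by apply: (mem_intersection_point (i := l)); rewrite ?bracket_diag // !inE nelj.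
rewrite hgen // memv0; apply/negP/polar_point_neq0 => //.
  by rewrite -cardJ' size_linear_product.
exact: linear_product_neq0.
Qed.

End OsculatingFamily.

Theorem corollary5p6 (d : nat) (hd : (3 <= d)%N) (k : closedFieldType)
    (hchar : [pchar k] =i pred0 \/ (exists2 p, p \in [pchar k] & (d < p)%N))
    (h : 'I_(d + 4) -> 'cV[k]_d.+1) (hn0 : forall i, h i != 0)
    (hgen : general_linear_position h)
    (hosc : osculate_rational_normal_curve h)
    (I : {set 'I_(d + 4)}) (i1 i2 i3 i4 i5 i6 : 'I_(d + 4))
    (hI : I = [set i1; i2; i3; i4; i5; i6])
    (hlt : [&& (i1 < i2)%N, (i2 < i3)%N, (i3 < i4)%N, (i4 < i5)%N
             & (i5 < i6)%N]) :
  let H := fun i => hyperplane (h i) in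
  let HJ := (\bigcap_(j in ~: I) H j)%VS in
  ((H i1 :&: H i2 + H i4 :&: H i5 :&: HJ)
     :&: (H i2 :&: H i3 + H i5 :&: H i6 :&: HJ)
     :&: (H i3 :&: H i4 + H i6 :&: H i1 :&: HJ)
     :&: HJ)%VS != 0%VS.
Proof.
have bin0 := bin_neq0 hchar.
have [F [[_ ndF] oscF]] := hosc; have unitF := nondegenerate_unitmx ndF.
have /fin_all_exists [u uP] i : exists u : 'rV[k]_2,
    u != 0 /\ osculating_hyperplane F (h i) u.
  by have [u] := oscF i; exists u.
have /fin_all_exists [c Fh] i : exists c : k, forall j : 'I_d.+1,
    (F *m h i) j 0 =
      c * ('C(d, j)%:R * (u i 0 0 ^+ j * (- u i 0 1) ^+ (d - j))).
  by apply: osculating_hyperplane_power; have [] := uP i.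
pose a i := u i 0 0; pose b i := - u i 0 1.
have ab0 i : (a i != 0) || (b i != 0).
  rewrite oppr_eq0 -negb_and; apply: contra (uP i).1 => /andP [/eqP u00 /eqP u01].
  exact/eqP/row2_eq0.
have c0 i : c i != 0.
  apply: contra (hn0 i) => /eqP ci0; rewrite -(mulKmx unitF (h i)).
  suff -> : F *m h i = 0 by rewrite mulmx0.
  by apply/colP => j; rewrite Fh ci0 mul0r mxE.
have br0 i j : i != j -> bracket a b i j != 0.
  apply: (bracket_neq0 bin0 Fh) => //; first exact: leq_trans hd.
  by rewrite -[X in (X < _)%N]addn0 ltn_add2l.
cbv zeta; set H := fun i => hyperplane (h i).
set HJ := (\bigcap_(j in ~: I) H j)%VS.
pose s := [:: i1; i2; i3; i4; i5; i6].
have uI : uniq s.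
  have srt : sorted ltn (map val s) by case/and5P: hlt => /= -> -> -> -> ->.
  by rewrite -(map_inj_uniq val_inj) (sorted_uniq ltn_trans ltnn).
have memI i : (i \in I) = (i \in s).
  by rewrite hI !inE !orbA.
have cardIc : #|~: I| = (d - 2)%N.
  rewrite cardsCs setCK card_ord (eq_card memI) (card_uniqP uI) /=.
  exact: (subnDr 4 d 2).
(* The vertex H i /\ H j of the hexagon, in the plane HJ. *)
pose y i j := polar_point F
  (linear_factor a b i * linear_factor a b j * linear_product a b (~: I)).
have yP i j : i \in I -> j \in I -> i != j ->
    y i j \in (H i :&: H j :&: HJ)%VS /\
    (forall l, l \in I -> l != i -> l != j -> y i j \notin H l).
  move=> iI jI neij; pose S := i |: (j |: ~: I).
  have jIc : j \notin ~: I by rewrite inE jI.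
  have iIc : i \notin j |: ~: I by rewrite !inE iI (negPf neij).
  have cardS : #|S| = d.
    by rewrite !cardsU1 iIc jIc cardIc addnA subnKC // ltnW.
  have yE : y i j = intersection_point F a b S.
    by rewrite /y -mulrA -!linear_productU1.
  have yH l : l \in S -> y i j \in H l.
    move=> lS; rewrite yE.
    by apply: (mem_intersection_point bin0 Fh cardS lS); apply: bracket_diag.
  split=> [|l lI neli nelj].
    rewrite !memv_cap !yH ?inE ?eqxx ?orbT //=.
    by apply/mem_bigcapv => l lI; rewrite yH // !inE -in_setC lI !orbT.
  rewrite mem_hyperplane yE (intersection_point_pairing bin0 Fh) //.
  rewrite -scalemx1 scalemx_eq0 (negPf (matrix_nonzero1 _ _)) orbF mulf_neq0 //.
  apply/prodf_neq0 => m mS; apply: br0; apply: contraTneq mS => ->.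
  by rewrite !inE (negPf neli) (negPf nelj) lI.
pose B := bracket a b.
have brianchon j1 j2 j3 j4 j5 j6 :
    (B j5 j3 * B j6 j4) *: y j1 j2 - (B j6 j2 * B j1 j3) *: y j4 j5 =
    (B j2 j4 * B j1 j3) *: y j5 j6 - (B j1 j5 * B j6 j4) *: y j2 j3.
  rewrite /y -!polar_pointB ![_ *: (_ * linear_product _ _ _)]scalerAl.
  by rewrite -!mulrBl brianchon_identity.
pose x := (B i5 i3 * B i6 i4) *: y i1 i2 - (B i6 i2 * B i1 i3) *: y i4 i5.
have x23 : x = (B i2 i4 * B i1 i3) *: y i5 i6 - (B i1 i5 * B i6 i4) *: y i2 i3.
  exact: brianchon.
(* The cyclic shift of the identity: its left-hand side is - x by x23. *)
have x34 : - x = (B i3 i5 * B i2 i4) *: y i6 i1 - (B i2 i6 * B i1 i5) *: y i3 i4.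
  rewrite -brianchon x23 opprB /B; congr (_ *: _ - _ *: _).
    by rewrite /bracket; ring.
  by rewrite mulrC.
(* Indexing the hexagon by 0, ..., 5 turns each condition that two of the i's are
   distinct into a computation. *)
pose p := nth i1 s.
have pI m : (m < 6)%N -> p m \in I by move=> lt_m; rewrite memI mem_nth.
have p_neq m n : (m < 6)%N -> (n < 6)%N -> m != n -> p m != p n.
  by move=> lt_m lt_n; rewrite (nth_uniq i1 (s := s)).
have vertex m n (lt_m : (m < 6)%N) (lt_n : (n < 6)%N) (nemn : m != n) :
    y (p m) (p n) \in (H (p m) :&: H (p n) :&: HJ)%VS.
  exact: (yP _ _ (pI m lt_m) (pI n lt_n) (p_neq m n lt_m lt_n nemn)).1.
have spanP (U V W : {vspace 'rV[k]_d.+1}) (e f : k) v w :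
    v \in (U :&: W)%VS -> w \in (V :&: W)%VS ->
  e *: v - f *: w \in ((U + V :&: W) :&: W)%VS.
  rewrite memv_cap => /andP [vU vW] wVW.
  have wW : w \in W := subvP (capvSr V W) w wVW.
  rewrite memv_cap [X in _ && X]rpredB ?rpredZ // andbT.
  by rewrite memv_add ?rpredN ?rpredZ.
have /memv_capP [x1 xJ] : x \in ((H i1 :&: H i2 + H i4 :&: H i5 :&: HJ) :&: HJ)%VS.
  exact: spanP (vertex 0 1 _ _ _) (vertex 3 4 _ _ _).
have /memv_capP [x2 _] : x \in ((H i2 :&: H i3 + H i5 :&: H i6 :&: HJ) :&: HJ)%VS.
  rewrite -rpredN x23 opprB.
  exact: spanP (vertex 1 2 _ _ _) (vertex 4 5 _ _ _).
have /memv_capP [x3 _] : x \in ((H i3 :&: H i4 + H i6 :&: H i1 :&: HJ) :&: HJ)%VS.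
  rewrite -[x]opprK x34 opprB.
  exact: spanP (vertex 2 3 _ _ _) (vertex 5 0 _ _ _).
(* H i1 contains the vertex y i1 i2 but not y i4 i5, whose coefficient in x is
   nonzero. *)
have x0 : x != 0.
  have y12 : y i1 i2 \in H i1.
    by have /memv_capP [/memv_capP [] ] := vertex 0 1 isT isT isT.
  have y45 : y i4 i5 \notin H i1.
    by apply: (yP _ _ (pI 3 _) (pI 4 _) (p_neq 3 4 _ _ _)).2 (pI 0 _)
      (p_neq 0 3 _ _ _) (p_neq 0 4 _ _ _).
  have B62 : B i6 i2 != 0 by apply: br0; apply: (p_neq 5 1).
  have B13 : B i1 i3 != 0 by apply: br0; apply: (p_neq 0 2).
  apply: contraNneq y45 => x0; have : x \in H i1 by rewrite x0 mem0v.
  rewrite /x rpredDl ?rpredZ // rpredN => y45B.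
  rewrite -[y i4 i5](scalerK (mulf_neq0 B62 B13)).
  exact: rpredZ y45B.
apply: contraNneq x0 => cap0; rewrite -memv0 -cap0.
by rewrite !memv_cap x1 x2 x3 xJ.
Qed.
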